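(* Let $\alpha,\beta$ be integers with $\alpha\equiv\beta\equiv 7\pmod 9$ and $v_3(\alpha-\beta)=2$. Then $|G_3|=3^{8}$, the nilpotency class of $G_3$ is $5$, $o(a)=o(b)=27$ and $o(c)=9$.
   Context: $G(\alpha,\beta)=\langle A,B\mid A^{[A,B]}=A^{\alpha},\ B^{[B,A]}=B^{\beta}\rangle$ with $[x,y]=x^{-1}y^{-1}xy$, $y^x=x^{-1}yx$, and $C=[A,B]$. The group $G(\alpha,\beta)$ is finite and nilpotent, hence the direct product of its Sylow subgroups; $G_3$ denotes its Sylow $3$-subgroup and $a,b,c$ denote the images of $A,B,C$ under the canonical projection $G(\alpha,\beta)\to G_3$. $v_3$ is the $3$-adic valuation and $o(x)$ the order of $x$. *)

(* Defs.v *)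
From HB Require Import structures.
From mathcomp Require Import all_boot all_order all_algebra all_fingroup all_solvable.
Set Implicit Arguments. Unset Strict Implicit. Unset Printing Implicit Defensive.
Import GRing.Theory.

Local Open Scope group_scope.

Definition expgz (gT : finGroupType) (x : gT) (z : int) : gT :=
  match z with
  | Posz n => x ^+ n
  | Negz n => x ^- n.+1
  end.

(* The defining relations of G(alpha,beta):
   A^[A,B] = A^alpha, B^[B,A] = B^beta, with MathComp conventions
   x ^ y = y^-1 x y and [~ x, y] = x^-1 y^-1 x y (same as the paper). *)
Definition Grel (gT : finGroupType) (alpha beta : int) (x y : gT) : Prop :=
  x ^ [~ x, y] = expgz x alpha /\ y ^ [~ y, x] = expgz y beta.

(* (G, A, B) is (a copy of) G(alpha,beta) with its canonical generators:
   G is generated by A, B which satisfy the relations, and G has the universal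
   property of the presentation with respect to all finite groups.  Since
   G(alpha,beta) is finite, this characterizes it up to isomorphism. *)
Definition is_Gab (gT : finGroupType) (alpha beta : int)
    (G : {group gT}) (A B : gT) : Prop :=
  G :=: <<[set A; B]>> /\ Grel alpha beta A B /\
  forall (hT : finGroupType) (x y : hT), Grel alpha beta x y ->
    exists f : {morphism G >-> hT}, f A = x /\ f B = y.

(* Main.v *)
(* Write [c = [~ x, y]] and let [x ^ c = x ^+ a], [y ^ c^-1 = y ^+ b] in a finite
   group. Since [x ^ y = x * c], conjugating [x] by [y ^+ (b ^ j)] in two ways
   yields a power of [y] inside [<[x]> * <[c]>]; its commutator with [c] lies in
   both cyclic groups, hence is central. The resulting congruence modulo #[x]
   forces every prime divisor of #[x] to divide [a - 1]; for the least prime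
   dividing #[x] * #[y] a power of [x], [y] or [c] is then central, so finite
   groups satisfying the relations are nilpotent by induction.

   In the Sylow 3-subgroup the same identity with [j = 1] gives, by induction
   through central quotients, [x ^+ 27 = y ^+ 27 = c ^+ 9 = 1], and
   [<[x]> * <[c]> * <[y]>] is the whole group, which has thus at most 3 ^ 8
   elements. Conversely the group acts transitively on 27 * 9 points with [y]
   fixing a point; exchanging the roles of [x] and [y] shows that 27 divides #[y],
   so that 3 ^ 8 divides the group order. The class is read off the orders of
   [x], [y] and [c]. *)
Require Import Defs.
From HB Require Import structures.
From mathcomp Require Import all_boot all_order all_algebra all_fingroup all_solvable.
From mathcomp Require Import zify.
Import GRing.Theory.

Set Implicit Arguments.
Unset Strict Implicit.
Unset Printing Implicit Defensive.

(** * Arithmetic of geometric sums and of powers modulo an integer *)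

(** The sum of [a ^ i] for [1 <= i <= k]: the exponent of [x] once [(x * c) ^+ k] is rewritten with
    all powers of [c] in front. *)
Fixpoint geom (a k : nat) : nat :=
  if k is k'.+1 then (a * (geom a k').+1)%N else 0%N.

Lemma geomE a k : (a * geom a k + a = geom a k + a ^ k.+1)%N.
Proof.
elim: k => [|k IHk] /=; first by rewrite muln0.
rewrite mulnS [(a + _)%N]addnC {1}IHk mulnDr -expnS; lia.
Qed.

Lemma ltn_totient n : 1 < n -> totient n < n.
Proof.
case: n => // -[//|n] _; rewrite totient_count_coprime big_mkord big_ord_recl.
rewrite /coprime gcdn0 add0n ltnS -[leqRHS]card_ord -sum1_card leq_sum // => i _.
by case: (_ == _).
Qed.

Lemma expn_mod1_dvd a d k q :
  a ^ d = 1 %[mod q] -> d %| k -> a ^ k = 1 %[mod q].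
Proof. by move=> ad /dvdnP[i ->]; rewrite mulnC expnM -modnXm ad modnXm exp1n. Qed.

Lemma eqn_mod_pmul_predn a n q : 0 < a -> prime q -> ~~ (q %| a.-1) ->
  forall u v, q %| n ->
  a.-1 ^ 2 * u = a.-1 ^ 2 * v %[mod n] -> u = v %[mod q].
Proof.
move=> a_gt0 q_pr q_a u v qn uv; apply/eqP.
have cq : coprime q (a.-1 ^ 2) by rewrite coprimeXr // prime_coprime.
have : a.-1 ^ 2 * u == a.-1 ^ 2 * v %[mod q].
  by rewrite -(modn_dvdm (_ * u) qn) -(modn_dvdm (_ * v) qn) uv.
wlog le_vu : u v {uv} / (v <= u)%N => [IH|].
  case/orP: (leq_total v u) => [/IH//|/IH h]; rewrite eq_sym => /h.
  by rewrite eq_sym.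
by rewrite !eqn_mod_dvd ?leq_mul // -mulnBr Gauss_dvdr.
Qed.

(* The order [d] of [a] modulo [q] divides [n], so [a] is a unit modulo [d] and
   [k := a ^ totient d] is [1] modulo [d]; the hypothesis at [j := totient d]
   then gives [k = 1] modulo [q], against [totient d < d]. *)
Lemma prime_dvd_predn_order a n q : 0 < a -> 0 < n -> prime q -> q %| n ->
  a ^ n = 1 %[mod n] ->
  (forall j, a.-1 ^ 2 * geom a (a ^ j) = a.-1 ^ 2 * a ^ (j + a ^ j) %[mod n]) ->
  q %| a.-1.
Proof.
move=> a_gt0 n_gt0 q_pr qn an1 key; apply/idPn => q_a.
have canceln := eqn_mod_pmul_predn a_gt0 q_pr q_a qn.
have q_gt1 := prime_gt1 q_pr.
have anq : a ^ n == 1 %[mod q] by rewrite -(modn_dvdm _ qn) an1 modn_dvdm.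
have exd : exists d, (0 < d) && (a ^ d == 1 %[mod q]).
  by exists n; rewrite n_gt0.
case: (ex_minnP exd) => d /andP[d_gt0 /eqP ad1] d_min.
have copan : coprime n a.
  have : coprime n (a ^ n) by rewrite -coprime_modr an1 coprime_modr coprimen1.
  by rewrite coprime_pexpr.
have copaq : coprime q a := coprime_dvdl qn copan.
have dn : d %| n.
  have : a ^ (n %% d) == 1 %[mod q].
    move: anq; rewrite {1}(divn_eq n d) expnD -modnMml.
    by rewrite (expn_mod1_dvd ad1 (dvdn_mull _ (dvdnn _))) modnMml mul1n.
  apply: contraTT; rewrite /dvdn -lt0n => nd_gt0; apply/negP => nd1.
  by have := d_min (n %% d); rewrite nd_gt0 nd1 leqNgt ltn_mod d_gt0 => /(_ isT).
have d_gt1 : 1 < d.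
  rewrite ltn_neqAle d_gt0 andbT; apply: contraNneq q_a => d1.
  by rewrite -subn1 -eqn_mod_dvd // -(expn1 a) {1}d1 ad1.
have copad : coprime a d by rewrite coprime_sym (coprime_dvdl dn).
have lt_td : totient d < d.
  exact: ltn_totient.
set k := a ^ totient d.
have k1 : k = 1 %[mod d] := Euler_exp_totient copad.
have k_gt0 : 0 < k by rewrite expn_gt0 a_gt0.
have ak : a ^ k = a %[mod q].
  rewrite -(subnK k_gt0) expnD expn1 -modnMml.
  by rewrite (expn_mod1_dvd ad1) ?modnMml ?mul1n // -eqn_mod_dvd ?k1.
have := canceln _ _ (key (totient d)); rewrite expnD -/k => tk.
have ga : geom a k = k * a %[mod q] by rewrite tk -modnMmr ak modnMmr.
(* Since [(a - 1) * geom a k = a ^ k.+1 - a], the congruences [ga] and [ak] leave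
   [a * (k - 1) * (a - 1) = 0] modulo [q]. *)
have : a * (k.-1 * a.-1) == 0 %[mod q].
  rewrite -(eqn_modDl (k * a + a * a)) addn0.
  have -> : k * a + a * a + a * (k.-1 * a.-1) = a * (k * a) + a.
    by move: a_gt0 k_gt0; case: (a) (k) => // a' [] // k' _ _ /=; nia.
  rewrite -modnDml -modnMmr -ga modnMmr modnDml geomE expnS -modnDml ga modnDml.
  by rewrite -modnDmr -modnMmr ak modnMmr modnDmr.
rewrite mod0n -/(dvdn _ _) Gauss_dvdr // Euclid_dvdM // (negPf q_a) orbF.
rewrite -subn1 -eqn_mod_dvd // => kq.
have := d_min (totient d); rewrite kq totient_gt0 d_gt0 leqNgt lt_td.
by move/(_ isT).
Qed.

Lemma modn1_dvd_predn m n : 0 < m -> (m == 1 %[mod n]) = (n %| m.-1).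
Proof. by move=> m_gt0; rewrite eqn_mod_dvd // subn1. Qed.

Lemma sum_expn_mod a k q : a = 1 %[mod q] -> \sum_(i < k) a ^ i = k %[mod q].
Proof.
move=> a1; rewrite -modn_summ -[in RHS](card_ord k) -sum1_card -[in RHS]modn_summ.
by congr (_ %% q); apply: eq_bigr => i _; rewrite -modnXm a1 modnXm exp1n.
Qed.

(** Raising some [t = 1] modulo [p] to the power [p] multiplies [t - 1] by a sum of [p] terms, each
    [1] modulo [p]. *)
Lemma dvdn_predn_expX a p v : 0 < a -> prime p -> p %| a.-1 ->
  p ^ v.+1 %| (a ^ p ^ v).-1.
Proof.
move=> a_gt0 p_pr pa; elim: v => [|v IHv]; first by rewrite expn0 !expn1.
rewrite expnSr [in (a ^ _)]expnSr expnM predn_exp dvdn_mul //.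
have av_gt0 : 0 < a ^ p ^ v by rewrite expn_gt0 a_gt0.
rewrite /dvdn (@sum_expn_mod _ _ p) ?modnn //; apply/eqP.
by rewrite modn1_dvd_predn // (dvdn_trans _ IHv) ?dvdn_exp.
Qed.

Lemma dvdn_predn_exp a d k : d %| k -> (a ^ d).-1 %| (a ^ k).-1.
Proof. by case/dvdnP=> i ->; rewrite mulnC expnM [X in _ %| X]predn_exp dvdn_mulr. Qed.

(** The [p]-part of [n] is covered by [dvdn_predn_expX]. For the rest, [a ^ (M * p) - 1] is
    [a ^ M - 1] times a sum congruent to [p] modulo each prime divisor of [n], hence coprime to the
    [p']-part. *)
Lemma expn_mod1_root a n p M : 0 < a -> 0 < n -> 0 < M -> prime p ->
  (forall q, prime q -> q %| n -> q %| a.-1) ->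
  a ^ (M * p) = 1 %[mod n] -> logn p n <= (logn p M).+1 -> a ^ M = 1 %[mod n].
Proof.
move=> a_gt0 n_gt0 M_gt0 p_pr n_a aMp le_nM.
have aM_gt0 : 0 < a ^ M by rewrite expn_gt0 a_gt0.
apply/eqP; rewrite modn1_dvd_predn // -(partnC p n_gt0) Gauss_dvd ?coprime_partC //.
apply/andP; split.
  have [pn | p'n] := boolP (p %| n); last first.
    by rewrite p_part lognE (negPf p'n) !andbF dvd1n.
  rewrite p_part (dvdn_trans (dvdn_exp2l p le_nM)) //.
  apply: dvdn_trans (dvdn_predn_expX _ a_gt0 p_pr (n_a _ p_pr pn)) _.
  exact/dvdn_predn_exp/pfactor_dvdnn.
have: n`_p^' %| (a ^ (M * p)).-1.
  rewrite (dvdn_trans (dvdn_part _ n)) // -modn1_dvd_predn ?aMp //.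
  by rewrite expn_gt0 a_gt0.
rewrite expnM predn_exp Gauss_dvdl // /coprime eqn_leq gcdn_gt0 part_gt0 andbT.
rewrite leqNgt; apply/negP=> /pdiv_prime; set q := pdiv _ => q_pr.
have /andP[qn qS] : (q %| n`_p^') && (q %| \sum_(i < p) (a ^ M) ^ i).
  by rewrite -dvdn_gcd pdiv_dvd.
have a1 : a ^ M = 1 %[mod q].
  apply: (@expn_mod1_dvd a 1) (dvd1n _); apply/eqP.
  by rewrite expn1 modn1_dvd_predn // n_a // (dvdn_trans qn) // dvdn_part.
move: qS; rewrite /dvdn (sum_expn_mod _ a1) -/(dvdn _ _) dvdn_prime2 // => /eqP qp.
have := pnatP p^' (part_gt0 _ _) (part_pnat _ n) q q_pr qn.
by rewrite qp !inE eqxx.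
Qed.

Lemma eq_geom_mod a r k m : a = r %[mod m] -> geom a k = geom r k %[mod m].
Proof.
move=> ar; elim: k => //= k IHk.
by rewrite -modnMm ar -addn1 -[in LHS]modnDml IHk modnDml addn1 modnMm.
Qed.

(** Reducing at every step keeps the unary numbers small when residues are enumerated by
    [vm_compute]. *)
Lemma geom_iter r k m : geom r k %% m = iter k (fun s => r * s.+1 %% m) 0%N %% m.
Proof.
by elim: k => //= k IHk; rewrite modn_mod -modnMmr -addn1 -modnDml IHk modnDml
  addn1 modnMmr.
Qed.

Lemma expn_iter r k m : r ^ k %% m = iter k (fun s => r * s %% m) 1%N %% m.
Proof. by elim: k => //= k IHk; rewrite modn_mod expnS -modnMmr IHk modnMmr. Qed.

Lemma mod9_eq7P (m : nat) (P : pred nat) a : a %% 9 = 7 -> 9 %| m -> 0 < m ->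
  all (fun r => (r %% 9 == 7) ==> P r) (iota 0 m) -> P (a %% m).
Proof.
move=> a7 m9 m_gt0 /allP allPm; have := allPm (a %% m).
by rewrite mem_iota add0n ltn_mod m_gt0 modn_dvdm // a7 => /(_ isT).
Qed.

(** Here [a - 1] has 3-adic valuation 1, so [a ^ 9 - 1] has valuation exactly 3. *)
Lemma gcdn81_expn9 a : a %% 9 = 7 -> gcdn 81 (a ^ 9 %% 81).-1 = 27.
Proof.
move=> a7; rewrite -modnXm expn_iter; apply/eqP.
by apply: (mod9_eq7P (m := 81) (P := fun r =>
  gcdn 81 (iter 9 (fun s => r * s %% 81) 1 %% 81).-1 == 27) a7); last by vm_compute.
Qed.

(** This congruence makes [Nrel_key] at [j = 1] collapse to an equality between powers of the
    commutator. *)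
Lemma geom_expn_mod27 a : a %% 9 = 7 ->
  geom (a %% 27) (a %% 27) = (a %% 27) ^ (a %% 27).+1 %[mod 27].
Proof.
rewrite geom_iter expn_iter => a7; apply/eqP.
by apply: (mod9_eq7P (m := 27) (P := fun r => iter r (fun s => r * s.+1 %% 27) 0 %% 27
  == iter r.+1 (fun s => r * s %% 27) 1 %% 27) a7); last by vm_compute.
Qed.

Lemma geom9_mod27 a : a %% 9 = 7 -> geom a 9 = 9 %[mod 27].
Proof.
rewrite -(eq_geom_mod 9 (modn_mod a 27)) geom_iter => a7; apply/eqP.
by apply: (mod9_eq7P (m := 27) (P := fun r =>
  iter 9 (fun s => r * s.+1 %% 27) 0 %% 27 == 9 %% 27) a7); last by vm_compute.
Qed.

Lemma geom3_mod9 a : a %% 9 = 7 -> geom a 3 = 3 %[mod 9].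
Proof. by move=> a7; rewrite -(eq_geom_mod 3 (modn_mod a 9)) a7. Qed.

Lemma expn3_mod9 a : a %% 9 = 7 -> a ^ 3 = 1 %[mod 9].
Proof. by move=> a7; rewrite -modnXm a7. Qed.

(** The order of [a] modulo 27 is 9, which does not divide [a - 1]. This is the source of the lower
    bound on the class. *)
Lemma expn_predn_mod27 a : a %% 9 = 7 -> (a %% 27) ^ (a %% 27).-1 != 1 %[mod 27].
Proof.
rewrite expn_iter => a7.
by apply: (mod9_eq7P (m := 27) (P := fun r =>
  iter r.-1 (fun s => r * s %% 27) 1 %% 27 != 1 %% 27) a7); last by vm_compute.
Qed.

Local Open Scope group_scope.

(** * Consequences of the relations *)

(** [Grel] with natural exponents: in a finite group, integer exponents matter only modulo the
    orders. *)
Definition Nrel (gT : finGroupType) (a b : nat) (x y : gT) : Prop :=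
  x ^ [~ x, y] = x ^+ a /\ y ^ [~ y, x] = y ^+ b.

Section Relations.

Variable gT : finGroupType.
Implicit Types (x y : gT) (a b : nat).

Lemma Nrel_sym a b x y : Nrel a b x y -> Nrel b a y x.
Proof. by case. Qed.

Lemma conjg_iter_exp a x c j : x ^ c = x ^+ a -> x ^ (c ^+ j) = x ^+ (a ^ j).
Proof.
move=> xc; elim: j => [|j IHj]; first by rewrite expg0 conjg1 expn0 expg1.
by rewrite expgSr conjgM IHj conjXg xc -expgM expnS.
Qed.

Lemma commg_conjg x y : x ^ y = x * [~ x, y].
Proof. by rewrite commgEl mulKVg. Qed.

Lemma expg_mul_comm a x c k :
  x ^ c = x ^+ a -> (x * c) ^+ k = c ^+ k * x ^+ geom a k.
Proof.
move=> xc; elim: k => [|k IHk]; first by rewrite mulg1.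
have xkc i : x ^+ i * c = c * x ^+ (a * i) by rewrite conjgC conjXg xc expgM.
by rewrite expgSr IHk -mulgA (mulgA (x ^+ _)) -expgSr xkc mulgA -expgSr.
Qed.

Lemma conjXg_gen a x y k : x ^ [~ x, y] = x ^+ a ->
  (x ^+ k) ^ y = [~ x, y] ^+ k * x ^+ geom a k.
Proof. by move=> xc; rewrite conjXg commg_conjg (expg_mul_comm _ xc). Qed.

Lemma conjg_genX a b x y k : Nrel a b x y ->
  x ^ (y ^+ k) = x * y ^- geom b k * [~ x, y] ^+ k * y ^+ k.
Proof.
case=> _ yc.
have -> : x ^ (y ^+ k) = x * (y ^+ k) ^- 1 ^ x * y ^+ k.
  by rewrite conjVg !conjgE !invMg !invgK !mulgA mulgV mul1g.
rewrite conjVg (conjXg_gen _ yc) invMg -[_ ^- k]expgVn invgR.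
by rewrite !mulgA.
Qed.

Lemma Nrel_conjV a b x y : Nrel a b x y -> y ^ [~ x, y]^-1 = y ^+ b.
Proof. by case=> _; rewrite invgR. Qed.

(* Conjugating [x] by [y ^+ (b ^ j) = y ^ (c ^- j)] in two ways. *)
Lemma Nrel_key a b x y j : Nrel a b x y ->
  y ^- geom b (b ^ j) * y ^+ (b ^ j * b ^ (b ^ j)) =
  x^-1 * [~ x, y] ^+ (j + a ^ j) * x ^+ geom a (a ^ j) *
    [~ x, y] ^- (j + b ^ j).
Proof.
move=> rel; have [xc _] := rel; have yc := Nrel_conjV rel.
set c := [~ x, y] in xc yc *.
have ycj i : y ^ (c ^- i) = y ^+ (b ^ i).
  by rewrite -expgVn; apply: conjg_iter_exp.
have E1 := conjg_genX (b ^ j) rel; rewrite -/c in E1.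
(* Second way: [y ^+ (b ^ j)] is [c ^+ j * y * c ^- j], so [x] is conjugated in turn by [c ^+ j],
   [y] and [c ^- j]. *)
have E2 : x ^ (y ^+ (b ^ j)) =
          c ^+ j * (c ^+ (a ^ j) * x ^+ geom a (a ^ j)) * c ^- j.
  rewrite -ycj [y ^ _]conjgE invgK !conjgM (conjg_iter_exp _ xc).
  by rewrite (conjXg_gen _ xc) -/c conjgE invgK !mulgA.
have cy : c ^+ (b ^ j) * y ^+ (b ^ j) =
          y ^+ (b ^ j * b ^ (b ^ j)) * c ^+ (b ^ j).
  rewrite mulnC expgM -(ycj (b ^ j)%N) -conjXg conjgE invgK -!mulgA mulVg mulg1 //.
rewrite -[x * _ * _ * _]mulgA cy in E1.
rewrite [(j + b ^ j)%N]addnC !expgD invMg; apply: (mulgI x).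
apply: (mulIg (c ^+ (b ^ j))); apply: (mulIg (c ^+ j)).
rewrite -!mulgA mulKVg mulKg mulVg mulg1 !mulgA.
rewrite !mulgA in E1.
by rewrite -E1 E2 !mulgA mulgKV.
Qed.

Lemma norm_cycle_conjX a x c : x ^ c = x ^+ a -> c \in 'N(<[x]>).
Proof. by move=> xc; rewrite -cycle_subG norms_cycle xc mem_cycle. Qed.

(** [Nrel_key] puts some [z * D] in [<[y]>], with [z] a power of [x] and [D] a power of [c].
    Conjugating by [c] and dividing shows that [z ^+ a.-1] lies in [<[x]>] and [<[y]>], so it
    commutes with [c]; as [z ^ c = z ^+ a], this kills [z ^+ (a.-1 ^ 2)]. *)
Lemma Nrel_key_expg a b x y j : 0 < a -> Nrel a b x y ->
  x ^+ (a.-1 ^ 2 * geom a (a ^ j)) = x ^+ (a.-1 ^ 2 * a ^ (j + a ^ j)).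
Proof.
move=> a_gt0 rel; have [xc _] := rel; have yc := Nrel_conjV rel.
have E := Nrel_key j rel.
set c := [~ x, y] in xc yc E; set M := (j + a ^ j)%N in E *.
set t := geom a _ in E *.
have nxc : c \in 'N(<[x]>) := norm_cycle_conjX xc.
have nyc : c \in 'N(<[y]>) by rewrite -groupV (norm_cycle_conjX yc).
pose z := x^-1 * (x ^+ t) ^ (c ^- M); pose D := c ^+ M * c ^- (j + b ^ j).
have zx : z \in <[x]>.
  rewrite groupM ?groupV ?cycle_id // memJ_norm ?mem_cycle //.
  by rewrite groupV groupX.
have Xy : z * D \in <[y]>.
  suff -> : z * D = y ^- geom b (b ^ j) * y ^+ (b ^ j * b ^ (b ^ j)).
    by rewrite groupM // ?groupV mem_cycle.
  by rewrite E /z /D conjgE invgK !mulgA mulgKV.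
have cD : D ^ c = D.
  by apply/conjg_fixP/commgP/commute_sym/commuteM; last apply: commuteV;
     apply: commuteX.
have zc : z ^ c = z ^+ a.
  by have /cycleP[i ->] := zx; rewrite conjXg xc -!expgM mulnC.
have zy : z ^+ a.-1 \in <[y]>.
  have -> : z ^+ a.-1 = (z * D) ^ c * (z * D)^-1.
    rewrite conjMg cD zc invMg -mulgA mulKVg -{2}(prednK a_gt0) expgSr mulgK //.
  by rewrite groupM ?groupV // memJ_norm.
have z1 : z ^+ (a.-1 ^ 2) = 1.
  have : commute (z ^+ a.-1) c.
    apply: commute_sym; rewrite /c /commg; apply: commute_sym.
    have cx : commute (z ^+ a.-1) x.
      by have /cycleP[i ->] := zx; apply: commute_sym; do 2!apply: commuteX.
    have cy : commute (z ^+ a.-1) y.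
      by have /cycleP[i ->] := zy; apply: commute_sym; apply: commuteX.
    by rewrite conjgE; do ![apply: commuteM | apply: commuteV].
  move/commgP/conjg_fixP; rewrite conjXg zc -expgM -{1}(prednK a_gt0) mulSn.
  by rewrite expgD -[in RHS](mulg1 (z ^+ a.-1)) => /mulgI; rewrite mulnn.
(* Conjugation by [c ^+ M] turns [z] into [x ^- (a ^ M) * x ^+ t], free of [c]. *)
have : (z ^ (c ^+ M)) ^+ (a.-1 ^ 2) = 1 by rewrite -conjXg z1 conj1g.
rewrite /z conjMg conjVg (conjg_iter_exp _ xc) -conjgM mulVg conjg1.
rewrite expgMn; last by apply: commuteX; apply/commute_sym/commuteV/commuteX.
rewrite expgVn -!expgM ![(_ * a.-1 ^ 2)%N]mulnC => /eqP.
by rewrite -eq_invg_mul invgK => /eqP.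
Qed.

(** [conjXg_gen] at [k = #[x]] has trivial left side; so that power of [c] lies in [<[x]>] and fixes
    [x]. *)
Lemma Nrel_expn_order a b x y : Nrel a b x y ->
  [~ x, y] ^+ #[x] = x ^- geom a #[x] /\ a ^ #[x] = 1 %[mod #[x]].
Proof.
case=> xc _; have := conjXg_gen #[x] xc.
rewrite expg_order conj1g => /esym/eqP; rewrite -eq_invg_mul.
set c := [~ x, y] in xc *.
move=> /eqP/(canRL (@invgK _)) ec; split=> //.
apply/eqP; rewrite -eq_expg_mod_order expg1.
rewrite -(conjg_iter_exp _ xc) -/c ec; apply/eqP/conjg_fixP/commgP.
by apply/commuteV/commuteX.
Qed.

End Relations.

(** * Nilpotency *)

Section Nilpotency.

Implicit Types gT : finGroupType.

Lemma Nrel_morph gT (rT : finGroupType) (D : {group gT})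
    (f : {morphism D >-> rT}) a b x y :
  x \in D -> y \in D -> Nrel a b x y -> Nrel a b (f x) (f y).
Proof.
move=> Dx Dy [xc yc].
by split; rewrite -morphR // -morphJ ?groupR // ?xc ?yc morphX.
Qed.

Lemma quotient_gen2 gT (x y : gT) (N : {group gT}) :
  x \in 'N(N) -> y \in 'N(N) ->
  <<[set x; y]>> / N = <<[set coset N x; coset N y]>>.
Proof.
move=> Nx Ny; rewrite quotient_gen; last by apply/subsetP=> z /set2P[]->.
by rewrite quotientU !quotient_set1.
Qed.

Lemma center_gen2 gT (x y z : gT) : z \in <<[set x; y]>> ->
  commute z x -> commute z y -> z \in 'Z(<<[set x; y]>>).
Proof.
move=> Gz zx zy; apply/centerP; split=> // w Gw.
have sG : <<[set x; y]>> \subset 'C[z].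
  by rewrite gen_subG; apply/subsetP=> u /set2P[]->; apply/cent1P/commute_sym.
exact/commute_sym/cent1P/(subsetP sG).
Qed.

Lemma Nrel_dvd_predn gT a b (x y : gT) q : 0 < a -> Nrel a b x y ->
  prime q -> q %| #[x] -> q %| a.-1.
Proof.
move=> a_gt0 rel q_pr qx; apply: prime_dvd_predn_order qx _ _ => //.
  by have [] := Nrel_expn_order rel.
by move=> j; apply/eqP; rewrite -eq_expg_mod_order (Nrel_key_expg j a_gt0 rel).
Qed.

(** The power [x0] of [x] of order [p] is central: [y] normalizes [<[x0]>], and its action, of order
    dividing [p.-1], is trivial because [#[y]] has no prime divisor below [p]. *)
Lemma Nrel_center_left gT a b (x y : gT) p : Nrel a b x y -> prime p ->
  (forall q, prime q -> q %| #[y] -> p <= q) ->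
  logn p #[[~ x, y]] < logn p #[x] -> 'Z(<<[set x; y]>>) != 1.
Proof.
move=> rel p_pr p_min; have [xc _] := rel; have [ec _] := Nrel_expn_order rel.
have xN k := conjXg_gen k xc.
set c := [~ x, y] in xc ec xN * => lt_cx.
have px : p %| #[x].
  by move: (leq_ltn_trans (leq0n _) lt_cx); rewrite logn_gt0 mem_primes => /and3P[].
have p_gt0 := prime_gt0 p_pr.
pose N := (#[x] %/ p)%N; pose x0 := x ^+ N.
have defx : #[x] = (N * p)%N by rewrite divnK.
have N_gt0 : 0 < N by rewrite divn_gt0 // dvdn_leq.
have ox0 : #[x0] = p by rewrite orderXdiv ?dvdn_div // divnA // mulKn.
have gN : gcdn #[x] #[c] %| N.
  have g_gt0 : 0 < gcdn #[x] #[c] by rewrite gcdn_gt0 order_gt0.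
  rewrite -(partnC p g_gt0) Gauss_dvd ?coprime_partC //; apply/andP; split.
    rewrite p_part pfactor_dvdn // -ltnS.
    have <- : logn p #[x] = (logn p N).+1.
      by rewrite defx lognM // (logn_prime _ p_pr) eqxx addn1.
    by apply: leq_trans lt_cx; rewrite ltnS dvdn_leq_log // dvdn_gcdr.
  have cp : coprime (gcdn #[x] #[c])`_p^' p.
    by rewrite coprime_sym prime_coprime // -p'natE // part_pnat.
  by rewrite -(Gauss_dvdl _ cp) -defx (dvdn_trans (dvdn_part _ _)) ?dvdn_gcdl.
have nxc : c \in 'N(<[x]>) := norm_cycle_conjX xc.
(* Modulo [<[x]>] the order of [c] divides both [#[x]] and [#[c]], hence [N] by [gN]. *)
have cN : c ^+ N \in <[x]>.
  apply: coset_idr; first exact: groupX.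
  rewrite morphX //; apply/eqP; rewrite -order_dvdn (dvdn_trans _ gN) //.
  rewrite dvdn_gcd !order_dvdn -[_ ^+ #[x]]morphX // -[_ ^+ #[c]]morphX //.
  by rewrite ec expg_order morph1 eqxx andbT /= coset_id ?groupV ?mem_cycle ?eqxx.
have /cycleP[i x0yi] : x0 ^ y \in <[x]> by rewrite xN groupM // mem_cycle.
have /dvdnP[r ir] : N %| i.
  rewrite -(dvdn_pmul2r p_gt0) -defx order_dvdn expgM -x0yi -conjXg.
  by rewrite -ox0 expg_order conj1g.
have x0y : x0 ^ y = x0 ^+ r by rewrite x0yi ir mulnC expgM.
have x0_neq1 : x0 != 1 by rewrite -order_gt1 ox0 prime_gt1.
have rp : r ^ p.-1 = 1 %[mod p].
  rewrite -totient_prime //; apply: Euler_exp_totient.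
  rewrite coprime_sym prime_coprime //; apply: contra x0_neq1 => pr.
  by rewrite -(conjg_eq1 _ y) x0y -order_dvdn ox0.
have x0yp : commute x0 (y ^+ p.-1).
  apply/commgP/conjg_fixP; rewrite (conjg_iter_exp _ x0y).
  by apply/eqP; rewrite -{2}(expg1 x0) eq_expg_mod_order ox0; apply/eqP.
have x0yC : commute x0 y.
  have cop : coprime #[y] p.-1.
    rewrite /coprime eqn_leq gcdn_gt0 order_gt0 andbT leqNgt; apply/negP=> g1.
    have := p_min _ (pdiv_prime g1) (dvdn_trans (pdiv_dvd _) (dvdn_gcdl _ _)).
    apply/negP; rewrite -ltnNge -[ltnRHS](prednK p_gt0) ltnS.
    have p1_gt0 : 0 < p.-1 by rewrite -ltnS prednK // prime_gt1.
    by rewrite dvdn_leq // (dvdn_trans (pdiv_dvd _)) ?dvdn_gcdr.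
  have : y \in <[y ^+ p.-1]>.
    by move: cop; rewrite -generator_coprime => /eqP <-; apply: cycle_id.
  by case/cycleP=> k ->; apply: commuteX.
apply/trivgPn; exists x0 => //; apply: center_gen2 => //.
  by rewrite groupX // mem_gen // set21.
exact/commute_sym/commuteX.
Qed.

(** A power [c ^+ k] fixes [x] exactly when [a ^ k = 1] modulo [#[x]], so [expn_mod1_root] descends
    from [M * p] to [M]. *)
Lemma Nrel_root_commute gT a b (x y : gT) p M : 0 < a -> 0 < M -> Nrel a b x y ->
  prime p -> [~ x, y] ^+ (M * p) = 1 -> logn p #[x] <= (logn p M).+1 ->
  commute x ([~ x, y] ^+ M).
Proof.
move=> a_gt0 M_gt0 rel p_pr cMp le_xM; have [xc _] := rel.
apply/commgP/conjg_fixP; rewrite (conjg_iter_exp _ xc).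
apply/eqP; rewrite -{2}(expg1 x) eq_expg_mod_order; apply/eqP.
apply: (@expn_mod1_root _ _ p) => //.
  by move=> q; apply: (Nrel_dvd_predn a_gt0 rel).
apply/eqP; rewrite -eq_expg_mod_order -(conjg_iter_exp _ xc) cMp conjg1 //.
Qed.

Lemma Nrel_center_neq1 gT a b (x y : gT) : 0 < a -> 0 < b -> Nrel a b x y ->
  <<[set x; y]>> != 1 -> 'Z(<<[set x; y]>>) != 1.
Proof.
move=> a_gt0 b_gt0 rel G_neq1; pose p := pdiv (#[x] * #[y]).
have [xc yc] := rel.
have xy_gt1 : 1 < #[x] * #[y].
  rewrite ltnNge; apply: contra G_neq1 => xy1; rewrite -subG1 gen_subG.
  have : (#[x] == 1%N) && (#[y] == 1%N).
    by rewrite -muln_eq1 eqn_leq xy1 muln_gt0 !order_gt0.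
  by rewrite !order_eq1 => /andP[/eqP-> /eqP->]; rewrite setUid.
have p_pr : prime p := pdiv_prime xy_gt1.
have p_min q : prime q -> (q %| #[x]) || (q %| #[y]) -> p <= q.
  by move=> q_pr; rewrite -Euclid_dvdM // => /pdiv_min_dvd-> //; apply: prime_gt1.
have [lt_cx | le_xc] := ltnP (logn p #[[~ x, y]]) (logn p #[x]).
  apply: Nrel_center_left rel p_pr _ lt_cx => q q_pr qy.
  by rewrite p_min // qy orbT.
have [lt_cy | le_yc] := ltnP (logn p #[[~ x, y]]) (logn p #[y]).
  rewrite setUC; apply: Nrel_center_left (Nrel_sym rel) p_pr _ _ => [q q_pr qx|].
    by rewrite p_min // qx.
  by rewrite -invgR orderV.
(* In the remaining case the [p]-part of the order of the commutator is at least those of [#[x]] and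
   [#[y]], and its power of order [p] is central. *)
have pc : p %| #[[~ x, y]].
  have : 0 < logn p #[x] + logn p #[y].
    by rewrite -lognM ?order_gt0 // logn_gt0 pi_pdiv.
  rewrite addn_gt0 => /orP[/leq_trans/(_ le_xc)|/leq_trans/(_ le_yc)];
    by rewrite logn_gt0 mem_primes => /and3P[].
pose M := (#[[~ x, y]] %/ p)%N.
have defc : #[[~ x, y]] = (M * p)%N by rewrite divnK.
have M_gt0 : 0 < M by rewrite divn_gt0 ?prime_gt0 // dvdn_leq.
have logM : logn p #[[~ x, y]] = (logn p M).+1.
  by rewrite defc (lognM _ M_gt0 (prime_gt0 p_pr)) (logn_prime _ p_pr) eqxx addn1.
have cMp : [~ x, y] ^+ (M * p) = 1 by rewrite -defc expg_order.
have cG : [~ x, y] ^+ M \in <<[set x; y]>>.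
  by rewrite groupX // groupR // mem_gen // ?set21 ?set22.
apply/trivgPn; exists ([~ x, y] ^+ M).
  apply: center_gen2 => //; apply: commute_sym.
    by apply: Nrel_root_commute a_gt0 M_gt0 rel p_pr cMp _; rewrite -logM.
  rewrite -[_ ^+ M]invgK; apply: commuteV; rewrite -expgVn invgR.
  apply: Nrel_root_commute b_gt0 M_gt0 (Nrel_sym rel) p_pr _ _.
    by rewrite -invgR expgVn cMp invg1.
  by rewrite -logM.
by rewrite -order_gt1 orderXdiv ?dvdn_div // divnA // mulKn ?prime_gt1.
Qed.

Lemma Nrel_nilpotent gT a b (x y : gT) : 0 < a -> 0 < b -> Nrel a b x y ->
  nilpotent <<[set x; y]>>.
Proof.
move=> a_gt0 b_gt0.
have [n leGn] := ubnP #|<<[set x; y]>>|.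
elim: n gT x y leGn => // n IHn gT x y leGn rel.
have [-> | G_neq1] := eqVneq <<[set x; y]>> 1; first exact: nilpotent1.
set G := <<[set x; y]>>%G; have nZ := normal_norm (center_normal G).
have Gx : x \in G by rewrite mem_gen ?set21.
have Gy : y \in G by rewrite mem_gen ?set22.
rewrite -(quotient_center_nil G) /=.
rewrite (quotient_gen2 (subsetP nZ x Gx) (subsetP nZ y Gy)).
apply: IHn; last by apply: Nrel_morph rel; apply: (subsetP nZ).
rewrite -(quotient_gen2 (subsetP nZ x Gx) (subsetP nZ y Gy)).
rewrite -ltnS (leq_trans _ leGn) // ltnS ltn_quotient ?center_sub //.
exact: Nrel_center_neq1 rel G_neq1.
Qed.

End Nilpotency.

(** * Exponents in a 3-group *)

Section ThreeGroup.

Implicit Types gT : finGroupType.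

Lemma Nrel_modn gT a b (x y : gT) m : #[x] %| m -> #[y] %| m ->
  Nrel a b x y -> Nrel (a %% m) (b %% m) x y.
Proof. by rewrite !order_dvdn => /eqP xm /eqP ym [xc yc]; split; rewrite expg_mod. Qed.

(** As [c ^+ 9] fixes [x], [#[x]] divides [a ^ 9 - 1] as well as 81. *)
Lemma Nrel_fixed_expn9 gT a (x c : gT) : a %% 9 = 7 -> x ^ c = x ^+ a ->
  x ^+ 81 = 1 -> commute (c ^+ 9) x -> x ^+ 27 = 1.
Proof.
move=> a7 xc x81 cx; apply/eqP; rewrite -order_dvdn -(gcdn81_expn9 a7) dvdn_gcd.
have x_81 : #[x] %| 81 by rewrite order_dvdn x81.
have r_gt0 : 0 < a ^ 9 %% 81.
  by case: posnP (gcdn81_expn9 a7) => // ->.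
rewrite x_81 /= -subn1 -eqn_mod_dvd // modn_dvdm //.
rewrite -eq_expg_mod_order expg1 -(conjg_iter_exp _ xc).
exact/eqP/conjg_fixP/commgP/commute_sym.
Qed.

(* Induction through the quotient by a central subgroup of order 3: there the
   three powers die, so in the group itself they are central of order dividing 3. *)
Lemma Nrel_exponents gT a b (x y : gT) : 3.-group <<[set x; y]>> ->
  a %% 9 = 7 -> b %% 9 = 7 -> a != b %[mod 27] -> Nrel a b x y ->
  [/\ x ^+ 27 = 1, y ^+ 27 = 1 & [~ x, y] ^+ 9 = 1].
Proof.
move=> + a7 b7 ab; have [n leGn] := ubnP #|<<[set x; y]>>|.
elim: n gT x y leGn => // n IHn gT x y leGn G3 rel.
set G := <<[set x; y]>>%G.
have Gx : x \in G by rewrite mem_gen ?set21.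
have Gy : y \in G by rewrite mem_gen ?set22.
have [G1 | G_neq1] := eqVneq <<[set x; y]>> 1.
  have [x1 y1] : x = 1 /\ y = 1 by split; apply/set1gP; rewrite -G1.
  by rewrite x1 y1 comm1g !expg1n.
have Z_neq1 : 'Z(G) != 1 by rewrite center_nil_eq1 ?(pgroup_nil G3).
have [_ Z3 _] := pgroup_pdiv (pgroupS (center_sub G) G3) Z_neq1.
have [//|z Zz oz] := Cauchy _ Z3.
set N := <[z]>%G; have sNZ : N \subset 'Z(G) by rewrite cycle_subG.
have cardN : #|N| = 3 by rewrite -oz.
have nN := normal_norm (sub_center_normal sNZ).
have nNx := subsetP nN x Gx; have nNy := subsetP nN y Gy.
have defQ : G / N = <<[set coset N x; coset N y]>> := quotient_gen2 nNx nNy.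
have [] := IHn _ (coset N x) (coset N y).
- rewrite -defQ -ltnS (leq_trans _ leGn) // ltnS ltn_quotient //.
    by rewrite -cardG_gt1 cardN.
  exact: subset_trans sNZ (center_sub _).
- by rewrite -defQ quotient_pgroup.
- exact: Nrel_morph nNx nNy rel.
rewrite -morphR // -!morphX // ?groupR // => x27 y27 c9.
have {x27}x27 : x ^+ 27 \in N by apply: coset_idr; rewrite ?groupX.
have {y27}y27 : y ^+ 27 \in N by apply: coset_idr; rewrite ?groupX.
have {c9}c9 : [~ x, y] ^+ 9 \in N by apply: coset_idr; rewrite ?groupX ?groupR.
have N3 u : u \in N -> u ^+ 3 = 1 by move=> Nu; rewrite -cardN expg_cardG.
have cN u w : u \in N -> w \in G -> commute u w.
  by move=> /(subsetP sNZ)/centerP[_ cu]; apply: cu.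
have {}x27 : x ^+ 27 = 1.
  apply: Nrel_fixed_expn9 a7 rel.1 _ (cN _ _ c9 Gx).
  by rewrite (expgM x 27 3) N3.
have {}y27 : y ^+ 27 = 1.
  apply: Nrel_fixed_expn9 b7 rel.2 _ (cN _ _ _ Gy).
    by rewrite (expgM y 27 3) N3.
  by rewrite -invgR expgVn groupV.
split=> //; set c := [~ x, y] in c9 *.
have x_27 : #[x] %| 27 by rewrite order_dvdn x27.
have y_27 : #[y] %| 27 by rewrite order_dvdn y27.
have relm := Nrel_modn x_27 y_27 rel; have := Nrel_key 1 relm.
rewrite !expn1 -/c !add1n -expnS.
(* The power of [x] becomes a conjugate by the adjacent power of [c], and the powers of [y] cancel.
   This leaves [c ^+ a.+1 = c ^+ b.+1] for the residues modulo 27, which excludes [#[c] = 27]. *)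
have -> : x ^+ geom (a %% 27) (a %% 27) = x ^ (c ^+ (a %% 27).+1).
  rewrite (conjg_iter_exp _ relm.1); apply/eqP.
  by rewrite eq_expg_mod_order -(modn_dvdm _ x_27) geom_expn_mod27 // modn_dvdm.
have -> : y ^+ ((b %% 27) ^ (b %% 27).+1) = y ^+ geom (b %% 27) (b %% 27).
  apply/eqP; rewrite eq_expg_mod_order.
  by rewrite -(modn_dvdm _ y_27) -geom_expn_mod27 // modn_dvdm.
rewrite mulVg -(mulgA x^-1) -conjgC mulgA mulVg mul1g => /esym/eqP.
rewrite -eq_mulgV1 eq_expg_mod_order => cab.
have : #[c] %| 3 ^ 3 by rewrite order_dvdn (expgM c 9 3) N3.
case/(dvdn_pfactor _ 3)=> // k le_k3 oc; apply/eqP; rewrite -order_dvdn oc.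
rewrite (dvdn_exp2l 3 (_ : k <= 2)) // -ltnS ltn_neqAle le_k3 andbT.
apply: contra ab => /eqP k3; move: cab.
by rewrite oc k3 -!(addn1 (_ %% 27)) eqn_modDr !modn_mod.
Qed.

End ThreeGroup.

(** * Order and nilpotency class *)

Section Structure.

Variables (gT : finGroupType) (a b : nat) (x y : gT).
Hypothesis rel : Nrel a b x y.

Local Notation c := [~ x, y].
Local Notation G := <<[set x; y]>>.

(** The product contains 1 and is stable under right multiplication by [x] and [y]: [x] moves left
    past [y ^+ l], creating [c ^- l], then past powers of [c], which normalize [<[x]>]. *)
Lemma Nrel_sub_prod : G \subset <[x]> * <[c]> * <[y]>.
Proof.
have nxc : c \in 'N(<[x]>) := norm_cycle_conjX rel.1.
set S := _ * <[y]>.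
suff sGN : G \subset 'N(S | 'R).
  apply/subsetP=> g /(subsetP sGN)/(astabs_act 1); rewrite /= mul1g => ->.
  by rewrite -[X in X \in _](mulg1 1) -{1}(mulg1 1) !mem_mulg ?group1.
have S_act g : S :* g \subset S -> g \in 'N(S | 'R).
  move=> sSg; rewrite !inE /=; apply/subsetP=> s Ss; rewrite inE /=.
  by apply: (subsetP sSg); rewrite mem_rcoset mulgK.
rewrite gen_subG; apply/subsetP=> _ /set2P[]->; apply: S_act; last first.
  by rewrite /S -mulgA rcoset_id ?cycle_id.
apply/subsetP=> _ /rcosetP[_ /mulsgP[u _ Hu /cycleP[l ->] ->] ->].
have -> : u * y ^+ l * x = u * x * c ^- l * y ^+ geom b l.
  by rewrite -!mulgA (conjgC _ x) (conjXg_gen l rel.2) -expgVn invgR !mulgA.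
apply: mem_mulg (mem_cycle _ _); case/mulsgP: Hu => v _ Hv /cycleP[k ->] ->.
have -> : v * c ^+ k * x * c ^- l = v * x ^ (c ^- k) * (c ^+ k * c ^- l).
  by rewrite conjgE invgK !mulgA mulgKV.
apply: mem_mulg; last by rewrite groupM ?groupV ?mem_cycle.
by rewrite groupM // memJ_norm ?cycle_id // groupV groupX.
Qed.

Lemma card_Nrel_leq : #|G| <= #[x] * #[c] * #[y].
Proof.
have leM (A B : {set gT}) : #|A * B| <= #|A| * #|B|.
  rewrite -cardsX; apply: leq_trans (leq_imset_card (fun u => u.1 * u.2) _).
  apply/subset_leq_card/subsetP=> _ /mulsgP[u v Au Bv ->].
  by apply/imsetP; exists (u, v); rewrite ?inE ?Au.
apply: leq_trans (subset_leq_card Nrel_sub_prod) _.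
by rewrite (leq_trans (leM _ _)) // leq_mul2r leM orbT.
Qed.

End Structure.

Section Class.

Implicit Types (gT : finGroupType) (a b n k m : nat).

Lemma mem_ucn_gen2 gT n (x y g : gT) (G := <<[set x; y]>>%G) :
  g \in G -> [~ g, x] \in 'Z_n(G) -> [~ g, y] \in 'Z_n(G) -> g \in 'Z_n.+1(G).
Proof.
move=> Gg gx gy; have nZ := normal_norm (ucn_normal n G).
have Nx : x \in 'N('Z_n(G)) by rewrite (subsetP nZ) // mem_gen ?set21.
have Ny : y \in 'N('Z_n(G)) by rewrite (subsetP nZ) // mem_gen ?set22.
have Ng := subsetP nZ g Gg.
have com w : w \in 'N('Z_n(G)) -> [~ g, w] \in 'Z_n(G) ->
    commute (coset 'Z_n(G) g) (coset 'Z_n(G) w).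
  by move=> Nw gw; apply/commgP; rewrite -morphR //= coset_id.
rewrite ucnSn mem_morphpre //= quotient_gen2 //.
apply: center_gen2; [|exact: com | exact: com].
by rewrite -quotient_gen2 // mem_quotient.
Qed.

Lemma expg_mod_cycle gT (u : gT) i j m : i = j %[mod m] ->
  u ^- i * u ^+ j \in <[u ^+ m]>.
Proof.
wlog le_ij : i j / i <= j => [IH ij | /esym/eqP].
  case/orP: (leq_total i j) => [/IH-> //|/IH/(_ (esym ij))].
  by rewrite -groupV invMg invgK.
rewrite eqn_mod_dvd // => /dvdnP[q jq].
by rewrite -(subnK le_ij) addnC expgD mulKg jq mulnC expgM mem_cycle.
Qed.

(** The commutator of [x ^+ k] with [y] is a conjugate of [c ^+ k] times a power of [x ^+ m]. *)
Lemma ucn_genX gT a b (x y : gT) n k m (G := <<[set x; y]>>%G) :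
  Nrel a b x y -> geom a k = k %[mod m] ->
  [~ x, y] ^+ k \in 'Z_n(G) -> x ^+ m \in 'Z_n(G) -> x ^+ k \in 'Z_n.+1(G).
Proof.
move=> rel ak ck xm; have Gx : x \in G by rewrite mem_gen ?set21.
apply: mem_ucn_gen2; first exact: groupX.
  by have /commgP/eqP-> : commute (x ^+ k) x; [exact/commute_sym/commuteX|].
rewrite commgEl (conjXg_gen k rel.1) mulgA.
have -> : x ^- k * [~ x, y] ^+ k * x ^+ geom a k =
          ([~ x, y] ^+ k) ^ (x ^+ k) * (x ^- k * x ^+ geom a k).
  by rewrite conjgE -!mulgA mulKVg.
rewrite groupM ?memJ_norm //.
  by rewrite (subsetP (normal_norm (ucn_normal n G))) ?groupX.
by apply: subsetP (expg_mod_cycle x (esym ak)); rewrite cycle_subG.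
Qed.

Lemma ucn_commX gT a b (x y : gT) n k m (G := <<[set x; y]>>%G) :
  Nrel a b x y -> a ^ k = 1 %[mod m] -> b ^ k = 1 %[mod m] ->
  x ^+ m \in 'Z_n(G) -> y ^+ m \in 'Z_n(G) -> [~ x, y] ^+ k \in 'Z_n.+1(G).
Proof.
move=> rel ak bk xm ym; have yc := Nrel_conjV rel.
have Gx : x \in G by rewrite mem_gen ?set21.
have Gy : y \in G by rewrite mem_gen ?set22.
have Gc : [~ x, y] ^+ k \in G by rewrite groupX ?groupR.
apply: mem_ucn_gen2 => //; rewrite commgEr.
  rewrite conjVg (conjg_iter_exp _ rel.1) -groupV invMg invgK -[x in x^-1 * _]expg1.
  by apply: subsetP (expg_mod_cycle x (esym ak)); rewrite cycle_subG.
have -> : y^-1 ^ ([~ x, y] ^+ k) * y = (y^-1 * y ^+ (b ^ k)) ^ ([~ x, y] ^+ k).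
  rewrite -(conjg_iter_exp k yc) conjMg -conjgM expgVn mulVg conjg1 //.
rewrite memJ_norm; last by rewrite (subsetP (normal_norm (ucn_normal n G))).
rewrite -{1}(expg1 y).
by apply: subsetP (expg_mod_cycle y (esym bk)); rewrite cycle_subG.
Qed.

(** Upper bound: the ninth powers of [x] and [y], then [c ^+ 3], then the cubes of [x] and [y], then
    [c], then [x] and [y] enter the successive terms of the upper central series. *)
Lemma Nrel_nil_class gT a b (x y : gT) (G := <<[set x; y]>>%G) :
  3.-group G -> Nrel a b x y -> a %% 9 = 7 -> b %% 9 = 7 ->
  #[x] = 27 -> y ^+ 27 = 1 -> [~ x, y] ^+ 9 = 1 -> nil_class G = 5.
Proof.
move=> G3 rel a7 b7 ox y27 c9; have nilG := pgroup_nil G3.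
have x27 : x ^+ 27 = 1 by rewrite -ox expg_order.
have Gx : x \in G by rewrite mem_gen ?set21.
have Gy : y \in G by rewrite mem_gen ?set22.
have symG : <<[set y; x]>>%G = G by apply: val_inj; rewrite /= setUC.
have yZ n k m : geom b k = k %[mod m] -> [~ x, y] ^+ k \in 'Z_n(G) ->
    y ^+ m \in 'Z_n(G) -> y ^+ k \in 'Z_n.+1(G).
  move=> bk; rewrite -groupV -expgVn invgR -symG.
  exact: ucn_genX (Nrel_sym rel) bk.
have mod3 r : r %% 9 = 7 -> r = 1 %[mod 3].
  by move=> r7; rewrite -(modn_dvdm r (isT : 3 %| 9)) r7.
have x9 : x ^+ 9 \in 'Z_1(G).
  by apply: (ucn_genX rel (geom9_mod27 a7)); rewrite ?c9 ?x27 group1.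
have y9 : y ^+ 9 \in 'Z_1(G).
  by apply: (yZ _ _ 27); rewrite ?geom9_mod27 ?c9 ?y27 ?group1.
have c3 : [~ x, y] ^+ 3 \in 'Z_2(G).
  exact: ucn_commX rel (expn3_mod9 a7) (expn3_mod9 b7) x9 y9.
have Z12 := subsetP (ucn_subS 1 G).
have x3 : x ^+ 3 \in 'Z_3(G) := ucn_genX rel (geom3_mod9 a7) c3 (Z12 _ x9).
have y3 : y ^+ 3 \in 'Z_3(G) := yZ _ _ _ (geom3_mod9 b7) c3 (Z12 _ y9).
have c1 : [~ x, y] ^+ 1 \in 'Z_4(G).
  by apply: ucn_commX rel _ _ x3 y3; rewrite expn1 mod3.
have Z34 := subsetP (ucn_subS 3 G).
have geom1 r : r %% 9 = 7 -> geom r 1 = 1 %[mod 3].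
  by move=> r7; rewrite /= muln1 mod3.
have x1 : x ^+ 1 \in 'Z_5(G) := ucn_genX rel (geom1 _ a7) c1 (Z34 _ x3).
have y1 : y ^+ 1 \in 'Z_5(G) := yZ _ _ _ (geom1 _ b7) c1 (Z34 _ y3).
apply/eqP; rewrite eqn_leq; apply/andP; split.
  apply/ucn_nil_classP => //; apply/eqP; rewrite eqEsubset ucn_sub gen_subG.
  by apply/subsetP=> u /set2P[]->.
(* Lower bound: [[~ x, c] = x ^+ r.-1] lies in ['L_3(G)], so a trivial ['L_5(G)] would make
   [[~ x ^+ r.-1, y]], hence [c ^+ r.-1], commute with [x], forcing [r ^ r.-1 = 1] modulo 27. *)
rewrite ltnNge; apply/negP=> /(lcn_nil_classP _ nilG) L5.
have LR n u v : u \in 'L_n.+1(G) -> v \in G -> [~ u, v] \in 'L_n.+2(G).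
  by move=> Lu Gv; rewrite lcnSn mem_commg.
pose r := a %% 27; have relr : Nrel r (b %% 27) x y.
  by apply: Nrel_modn rel; rewrite ?ox // order_dvdn y27.
have r_gt0 : 0 < r.
  by case: posnP (modn_dvdm a (isT : 9 %| 27)) => //; rewrite a7 -/r => ->.
have xL3 : x ^+ r.-1 \in 'L_3(G).
  have := LR 1%N _ _ (LR 0%N x y Gx Gy) Gx.
  by rewrite -groupV invgR commgEl relr.1 -{1}(prednK r_gt0) expgS mulKg.
have := LR 3 _ _ (LR 2 _ y xL3 Gy) Gx; rewrite L5 => /set1gP/eqP/commgP/commute_sym.
move/commgP/conjg_fixP; rewrite commgEl (conjXg_gen _ relr.1) !conjgM.
have fx i : x ^ (x ^+ i) = x by apply/conjg_fixP/commgP/commuteX.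
have -> : x ^ (x ^- r.-1) = x by rewrite -{1}(fx r.-1) conjgK.
rewrite (conjg_iter_exp _ relr.1) conjXg fx => /eqP.
rewrite -{2}(expg1 x) eq_expg_mod_order ox; apply/negP; exact: expn_predn_mod27.
Qed.

End Class.

(** * A transitive action *)

(* Permutations of the form (i, k) |-> (f i, k + h i). In G(r, s) with generators
   A and B, the pair (i, k) stands for the right coset of <B> containing
   C ^ (- k) * A ^ (- i), on which right multiplication by A and B acts as the
   permutations X and Y below, and that by C as (i, k) |-> (r * i, k - 1). *)
Section Model.

Local Open Scope nat_scope.

Local Notation D := ('I_27 * 'I_9)%type.
Implicit Types (f h : nat -> nat) (p : D).

Definition skew f h p : D := (inZp (f p.1), inZp (p.2 + h p.1)).

Definition skew_eqb f h f' h' := all (fun i =>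
  (f i %% 27 == f' i %% 27) && (h i %% 9 == h' i %% 9)) (iota 0 27).

Lemma eq_skew f h f' h' : skew_eqb f h f' h' -> skew f h =1 skew f' h'.
Proof.
move=> /allP eqfh [i k]; have /eqfh/andP[/eqP fi /eqP hi] : val i \in iota 0 27.
  by rewrite mem_iota ltn_ord.
by congr (_, _); apply: val_inj; rewrite /= ?fi // -modnDmr hi modnDmr.
Qed.

Lemma skew_comp f h f' h' p : skew f h (skew f' h' p) =
  skew (fun i => f (f' i %% 27)) (fun i => h' i + h (f' i %% 27))%N p.
Proof. by congr (_, _); apply: val_inj; rewrite //= modnDml addnA. Qed.

(** The orbit of [i] under [f] and the accumulated shift: iterates of a skew map are again skew, so
    their equality needs only 27 tests. *)
Definition skewX n f h i : nat * nat :=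
  iter n (fun u => (f (u.1 %% 27), u.2 + h (u.1 %% 27))%N) (i, 0%N).

Lemma iter_skew n f h p : iter n (skew f h) p =
  skew (fun i => (skewX n f h i).1) (fun i => (skewX n f h i).2) p.
Proof.
elim: n => [|n IHn] /=; last by rewrite IHn skew_comp.
by case: p => i k; congr (_, _); rewrite ?addn0; apply: val_inj; rewrite /= modn_small.
Qed.

Lemma skew_inj f h : uniq [seq f i %% 27 | i <- iota 0 27] -> injective (skew f h).
Proof.
move=> Uf [i k] [j l] [/= fij kl].
have ij : i = j.
  apply/val_inj/eqP; rewrite -(nth_uniq 0%N _ _ Uf) ?size_map ?size_iota ?ltn_ord //.
  by rewrite !(nth_map 0%N) ?size_iota ?ltn_ord // !nth_iota ?ltn_ord // !add0n fij.
move: kl; rewrite -{}ij => /eqP; rewrite eqn_modDr !modn_small // => /eqP kl.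
by congr (_, _); apply: val_inj.
Qed.

(* The inverse of [r] modulo 27, as [r ^ 9 = 1] modulo 27 when [r = 1] modulo 3. *)
Definition inv27 r := iter 8 (fun t => r * t %% 27) 1.
(* [gsum r i] is the sum of the [inv27 r ^ t] for [t < i]. *)
Definition gsum r := let q := inv27 r in fun i => iter i (fun t => (q * t).+1 %% 27) 0.

(** Translation by [-1] modulo 27; likewise 8 stands for [-1] modulo 9 below. *)
Definition shiftf i := (i + 26)%N.
Definition zero_fun (i : nat) := 0%N.

Lemma shift_inj : injective (skew shiftf zero_fun).
Proof. by apply: skew_inj; vm_compute. Qed.

(** The first two tests give bijectivity of [Y] and [C]. The others say [Y * X * C = X * Y],
    [X * C = C * X ^+ r] and [C * Y = Y ^+ s * C], in the form produced by [skew_comp] and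
    [iter_skew]. *)
Definition model_check r s :=
  [&& uniq [seq gsum r i %% 27 | i <- iota 0 27],
      uniq [seq r * i %% 27 | i <- iota 0 27],
      skew_eqb (fun i => r * (shiftf (gsum r i %% 27) %% 27))
        (fun i => i + (0 + 8))
        (fun i => gsum r (shiftf i %% 27)) (fun i => 0 + shiftf i %% 27),
      skew_eqb (fun i => r * (shiftf i %% 27)) (fun i => 0 + 8)
        (fun i => (skewX r shiftf zero_fun (r * i %% 27)).1)
        (fun i => 8 + (skewX r shiftf zero_fun (r * i %% 27)).2) &
      skew_eqb (fun i => gsum r (r * i %% 27)) (fun i => 8 + r * i %% 27)
        (fun i => r * ((skewX s (gsum r) id i).1 %% 27))
        (fun i => (skewX s (gsum r) id i).2 + 8)].

Definition model_expn_check r n :=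
  skew_eqb (fun i => (skewX n shiftf zero_fun i).1)
        (fun i => (skewX n shiftf zero_fun i).2) id zero_fun
  && skew_eqb (fun i => (skewX n (gsum r) id i).1)
        (fun i => (skewX n (gsum r) id i).2) id zero_fun.

Lemma skew_id p : skew id zero_fun p = p.
Proof.
by case: p => i k; congr (_, _); apply: val_inj; rewrite /= ?addn0 modn_small.
Qed.

Lemma exists_model r s n : model_check r s -> model_expn_check r n ->
  exists X Y : {perm D}, [/\ Nrel r s X Y, (X ^+ n = 1)%g, (Y ^+ n = 1)%g &
    [/\ X =1 skew shiftf zero_fun, Y =1 skew (gsum r) id &
        [~ X, Y]%g =1 skew (muln r) (fun=> 8)]].
Proof.
case/and5P=> Ug Ur R1 R2 R3 /andP[Xn Yn].
pose X := perm shift_inj; pose Y := perm (skew_inj (h := id) Ug).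
pose C := perm (skew_inj (h := fun=> 8) Ur); exists X, Y.
have XE k p : (X ^+ k)%g p = iter k (skew shiftf zero_fun) p.
  by rewrite permX; apply: eq_iter => q; rewrite permE.
have YE k p : (Y ^+ k)%g p = iter k (skew (gsum r) id) p.
  by rewrite permX; apply: eq_iter => q; rewrite permE.
have defC : [~ X, Y]%g = C.
  have XY : (Y * X * C = X * Y)%g.
    apply/permP=> p; rewrite !permM !permE !skew_comp; exact: (eq_skew R1 p).
  by rewrite commgEl conjgE -XY -!mulgA !mulKg.
split; last 1 first.
- by split=> p; rewrite ?defC permE.
- split; last rewrite -invgR; rewrite defC conjgE.
    apply: (canLR (mulKg _)); apply/permP=> p.
    rewrite !permM XE !permE iter_skew !skew_comp; exact: (eq_skew R2 p).
  rewrite invgK mulgA; apply: (canLR (mulgK _)); apply/permP=> p.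
  rewrite !permM YE iter_skew !permE !skew_comp; exact: (eq_skew R3 p).
- apply/permP=> p; rewrite XE iter_skew perm1 -[RHS]skew_id; exact: (eq_skew Xn p).
- apply/permP=> p; rewrite YE iter_skew perm1 -[RHS]skew_id; exact: (eq_skew Yn p).
Qed.

Definition origin : D := (inZp 0, inZp 0).

Lemma mod27_eq a : a %% 9 = 7 -> a %% 27 \in [:: 7; 16; 25].
Proof. by move=> a7; apply: (mod9_eq7P a7 (P := mem [:: 7; 16; 25])). Qed.

Lemma exists_transitive_model a b : a %% 9 = 7 -> b %% 9 = 7 ->
  exists X Y : {perm D}, [/\ Nrel a b X Y, (X ^+ 27 = 1)%g, (Y ^+ 27 = 1)%g &
    [/\ 27 %| #[X]%g, Y origin = origin & #|orbit 'P <<[set X; Y]>>%g origin| = 243]].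
Proof.
move=> /mod27_eq a27 /mod27_eq b27.
have ok : all (fun r => all (fun s => model_check r s && model_expn_check r 27)
    [:: 7; 16; 25]) [:: 7; 16; 25] by vm_compute.
have /andP[check1 check2] := allP (allP ok _ a27) _ b27.
have [X [Y [[Xc Yc] X27 Y27 [XE YE cE]]]] := exists_model check1 check2.
clear ok check1 check2; exists X, Y.
have Xn n i k : (X ^+ n)%g (inZp i, k) = (inZp (i + 26 * n), k).
  elim: n => [|n IHn]; first by rewrite expg0 perm1 muln0 addn0.
  rewrite expgSr permM IHn XE; congr (_, _); apply: val_inj => /=.
    by rewrite /shiftf modnDml; congr (_ %% _); lia.
  by rewrite addn0 modn_small.
have cn n : ([~ X, Y] ^+ n)%g origin = (inZp 0, inZp (8 * n)).
  elim: n => [|n IHn]; first by rewrite expg0 perm1 muln0.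
  rewrite expgSr permM IHn cE; congr (_, _); apply: val_inj => /=.
    by rewrite muln0.
  by rewrite modnDml; congr (_ %% _); lia.
have X_27 : #[X]%g %| 3 ^ 3 by rewrite order_dvdn; apply/eqP.
have relXY : Nrel a b X Y.
  by split; [rewrite Xc (expg_mod a X27) | rewrite Yc (expg_mod b Y27)].
split; [exact: relXY | exact: X27 | exact: Y27 | split].
- case/(dvdn_pfactor _ 3): X_27 => // n _ oX.
  rewrite oX (dvdn_exp2l 3 (_ : 3 <= n)) // leqNgt; apply/negP => lt_n3.
  have X9 : (X ^+ 9 = 1)%g.
    by apply/eqP; rewrite -order_dvdn oX (dvdn_exp2l 3 (_ : n <= 2)).
  by have := Xn 9 0 (inZp 0); rewrite X9 perm1 => /(congr1 (fun u => val u.1)).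
- by rewrite YE.
suff -> : orbit 'P <<[set X; Y]>>%g origin = [set: D].
  by rewrite cardsT card_prod !card_ord.
apply/setP=> -[i k]; rewrite inE; apply/orbitP.
(* 8 and 26 are their own inverses modulo 9 and 27. *)
exists ([~ X, Y] ^+ (8 * k) * X ^+ (26 * i))%g.
  by rewrite groupM ?groupX ?groupR // mem_gen // ?set21 ?set22.
rewrite /= apermE permM cn Xn; congr (_, _); apply: val_inj => /=.
  rewrite add0n mulnA -modnMml mul1n modn_small //.
by rewrite mulnA -modnMml mul1n modn_small.
Qed.

End Model.

(** * Sylow 3-subgroups *)

Lemma expgz_eqmod (gT : finGroupType) (x : gT) (z : int) (a N : nat) :
  x ^+ N = 1 -> (z = a %[mod N])%Z -> expgz x z = x ^+ a.
Proof.
move=> xN /eqP; case: z => n /=.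
  by rewrite !modz_nat eqz_nat => /eqP na; rewrite -(expg_mod n xN) na expg_mod.
rewrite eq_sym eqz_mod_dvd NegzE opprK dvdzE -PoszD !absz_nat => Na.
apply/eqP; rewrite eq_invg_mul -expgD addnC -order_dvdn.
by rewrite (dvdn_trans _ Na) // order_dvdn xN.
Qed.

Lemma Nrel_Grel (gT : finGroupType) (x y : gT) (alpha beta : int) (a b N : nat) :
  x ^+ N = 1 -> y ^+ N = 1 ->
  (alpha = a %[mod N])%Z -> (beta = b %[mod N])%Z ->
  Grel alpha beta x y <-> Nrel a b x y.
Proof.
by move=> xN yN aN bN; rewrite /Grel (expgz_eqmod xN aN) (expgz_eqmod yN bN).
Qed.

Lemma modz_abs (z : int) (N : nat) : 0 < N -> (z = `|(z %% N)%Z|%N %[mod N])%Z.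
Proof. by move=> N_gt0; rewrite gez0_abs ?modz_mod // modz_ge0 // -lt0n. Qed.

Lemma eqz_mod_dvdn (z w : int) (N d : nat) :
  d %| N -> (z = w %[mod N])%Z -> (z = w %[mod d])%Z.
Proof.
move=> dN /eqP; rewrite eqz_mod_dvd => Nzw.
by apply/eqP; rewrite eqz_mod_dvd (dvdz_trans _ Nzw).
Qed.

Lemma absz_mod7 (z : int) (N : nat) : 0 < N -> 9 %| N -> (z = 7 %[mod 9])%Z ->
  `|(z %% N)%Z|%N %% 9 = 7.
Proof.
move=> N_gt0 N9 z7; apply/eqP; rewrite -eqz_nat -modz_nat.
by rewrite -(eqz_mod_dvdn N9 (modz_abs z N_gt0)) z7.
Qed.

(** [G] acts transitively on 243 points through the model, and the stabilizer of the origin contains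
    [B]. *)
Lemma is_Gab_card (alpha beta : int) (gT : finGroupType) (G : {group gT}) (A B : gT) :
  (alpha = 7 %[mod 9])%Z -> (beta = 7 %[mod 9])%Z ->
  is_Gab alpha beta G A B -> 3 ^ 8 %| #|G|.
Proof.
move=> alpha7 beta7 [defG [_ univ]].
have GA : A \in G by rewrite defG mem_gen ?set21.
have GB : B \in G by rewrite defG mem_gen ?set22.
pose a := `|(alpha %% 27)%Z|%N; pose b := `|(beta %% 27)%Z|%N.
have a7 : a %% 9 = 7 by apply: absz_mod7 alpha7.
have b7 : b %% 9 = 7 by apply: absz_mod7 beta7.
have alphaE : (alpha = a %[mod 27])%Z := @modz_abs alpha 27 isT.
have betaE : (beta = b %[mod 27])%Z := @modz_abs beta 27 isT.
(* In the model for the exchanged exponents, [B] maps to the generator whose order is divisible by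
   27. *)
have B27 : 27 %| #[B].
  have [X [Y [rel X27 Y27 [oX _ _]]]] := exists_transitive_model b7 a7.
  have [f [_ fB]] := univ _ Y X ((Nrel_Grel Y27 X27 alphaE betaE).2 (Nrel_sym rel)).
  by rewrite (dvdn_trans oX) // -fB morph_order.
have [X [Y [rel X27 Y27 [_ Y0 orb]]]] := exists_transitive_model a7 b7.
have [f [fA fB]] := univ _ X Y ((Nrel_Grel X27 Y27 alphaE betaE).2 rel).
have sAB : [set A; B] \subset G by rewrite defG subset_gen.
have imf : f @* G = <<[set X; Y]>>.
  transitivity (f @* <<[set A; B]>>); first by rewrite -defG.
  by rewrite morphim_gen // morphimU !morphim_set1 // fA fB.
pose S := 'C_(f @* G)[origin | 'P]%G.
have sSf : S \subset f @* G by apply: subsetIl.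
have cardG : (#|G| = 243 * #|f @*^-1 S|)%N.
  rewrite (card_morphpre sSf) mulnCA -orb -imf card_orbit_stab.
  by rewrite -(card_morphpre (subxx _)) morphimGK ?subsetIl.
have BS : B \in f @*^-1 S.
  rewrite mem_morphpre // inE mem_morphim //=; apply/astab1P.
  by rewrite /= apermE fB Y0.
rewrite cardG (@dvdn_mul (3 ^ 5) (3 ^ 3)) // (dvdn_trans B27) //.
exact: order_dvdG.
Qed.

(** * Projection of a nilpotent group onto a Sylow subgroup *)

Section ConsttMorphism.

Variables (gT : finGroupType) (p : nat) (G : {group gT}).
Hypothesis nilG : nilpotent G.

Lemma mem_pcore_constt (pi : nat_pred) u : u \in G -> u.`_pi \in 'O_pi(G).
Proof.
move=> Gu; rewrite (mem_normal_Hall (nilpotent_pcore_Hall pi nilG)) ?pcore_normal //.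
  exact: p_elt_constt.
by rewrite groupX.
Qed.

(** The subgroups ['O_p(G)] and ['O_p^'(G)] centralize each other, so the [p]- and [p']-constituents
    of [u] and [v] can be regrouped. *)
Lemma consttM_nil : {in G &, {morph (fun u : gT => u.`_p) : u v / u * v}}.
Proof.
move=> u v Gu Gv; have [_ _ cKH _] := dprodP (nilpotent_pcoreC p nilG).
have com w z : w \in 'O_p(G) -> z \in 'O_p^'(G) -> commute w z.
  by move=> Ow Oz; apply/commute_sym/(centsP cKH).
have Op w : w \in G -> w.`_p \in 'O_p(G) by apply: mem_pcore_constt.
have Op' w : w \in G -> w.`_p^' \in 'O_p^'(G) by apply: mem_pcore_constt.
have -> : u * v = (u.`_p * v.`_p) * (u.`_p^' * v.`_p^').
  rewrite -{1}(consttC p u) -{1}(consttC p v) -!mulgA; congr (_ * _).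
  by rewrite !mulgA (com _ _ (Op v Gv) (Op' u Gu)).
rewrite consttM; last by apply: com; rewrite groupM ?Op ?Op'.
rewrite constt_p_elt; last by rewrite (mem_p_elt (pcore_pgroup p G)) // groupM ?Op.
have /constt1P-> : p^'.-elt (u.`_p^' * v.`_p^'); last by rewrite mulg1.
by rewrite (mem_p_elt (pcore_pgroup p^' G)) // groupM ?Op'.
Qed.

Definition constt_morphism := Morphism consttM_nil.

Lemma constt_morphism_Sylow (P : {group gT}) :
  P \in 'Syl_p(G) -> constt_morphism @* G = P.
Proof.
rewrite inE => sylP; rewrite (nilpotent_Hall_pcore nilG sylP).
apply/eqP; rewrite eqEsubset; apply/andP; split.
  by apply/subsetP=> _ /morphimP[u _ Gu ->]; apply: mem_pcore_constt.
apply/subsetP=> u Ou; have Gu := subsetP (pcore_sub p G) u Ou.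
have uE : u = constt_morphism u.
  by rewrite /= constt_p_elt // (mem_p_elt (pcore_pgroup p G)).
by rewrite uE mem_morphim.
Qed.

End ConsttMorphism.

Lemma leq_mul3_eq (k l m K L M : nat) : k <= K -> l <= L -> m <= M ->
  0 < K * L * M -> K * L * M <= k * l * m -> [/\ k = K, l = L & m = M].
Proof.
move=> kK lL mM KLM_gt0 leKLM.
have [le_klm] := leqif_mul (leqif_mul (leqif_eq kK) (leqif_eq lL)) (leqif_eq mM).
rewrite eqn_leq le_klm leKLM muln_eq0 => /esym.
move: KLM_gt0; rewrite !muln_gt0 !lt0n => /andP[/andP[K0 L0] M0].
rewrite !muln_eq0 (negPf K0) (negPf L0) (negPf M0) /=.
by move=> /andP[/andP[/eqP-> /eqP->] /eqP->].
Qed.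

Lemma Nrel_Sylow3 (gT : finGroupType) (a b : nat) (x y : gT)
    (G := <<[set x; y]>>%G) (P : {group gT}) :
  a %% 9 = 7 -> b %% 9 = 7 -> a != b %[mod 27] -> Nrel a b x y ->
  3 ^ 8 %| #|G| -> P \in 'Syl_3(G) ->
  [/\ #|P| = (3 ^ 8)%N, nil_class P = 5,
      #[x.`_3] = 27, #[y.`_3] = 27 & #[[~ x, y].`_3] = 9].
Proof.
move=> a7 b7 nab rel G_38 sylP.
have Gx : x \in G by rewrite mem_gen ?set21.
have Gy : y \in G by rewrite mem_gen ?set22.
have a_gt0 : 0 < a by case: posnP a7 => // ->.
have b_gt0 : 0 < b by case: posnP b7 => // ->.
have nilG : nilpotent G := Nrel_nilpotent a_gt0 b_gt0 rel.
pose f := constt_morphism 3 nilG.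
have fxy : [~ x.`_3, y.`_3] = [~ x, y].`_3 := esym (morphR f Gx Gy).
have {}rel : Nrel a b x.`_3 y.`_3 := @Nrel_morph _ _ _ f _ _ _ _ Gx Gy rel.
have defP : P :=: <<[set x.`_3; y.`_3]>>.
  rewrite -(constt_morphism_Sylow nilG sylP) -/f.
  by rewrite morphim_gen ?subset_gen // morphimU !morphim_set1.
have sylP' : 3.-Sylow(G) P by rewrite inE in sylP.
have P3 : 3.-group <<[set x.`_3; y.`_3]>> by rewrite -defP (pHall_pgroup sylP').
have P_38 : 3 ^ 8 <= #|P|.
  by rewrite (card_Hall sylP') p_part leq_exp2l // -pfactor_dvdn.
have [x27 y27 c9] := Nrel_exponents P3 a7 b7 nab rel.
have := card_Nrel_leq rel; rewrite -defP => leP.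
have le_x : #[x.`_3] <= 27 by rewrite dvdn_leq // order_dvdn x27.
have le_y : #[y.`_3] <= 27 by rewrite dvdn_leq // order_dvdn y27.
have le_c : #[[~ x.`_3, y.`_3]] <= 9 by rewrite dvdn_leq // order_dvdn c9.
(* Since [27 * 9 * 27 = 3 ^ 8], all three bounds on the orders are attained. *)
have [//|ox oc oy] := leq_mul3_eq le_x le_c le_y _ (leq_trans P_38 leP).
rewrite -fxy; split=> //.
  by apply/eqP; rewrite eqn_leq P_38 (leq_trans leP) // ox oy oc.
have -> : P = <<[set x.`_3; y.`_3]>>%G by apply: val_inj.
exact: Nrel_nil_class P3 rel a7 b7 ox y27 c9.
Qed.

Close Scope group_scope.

Theorem theorem9p2 (alpha beta : int) (gT : finGroupType) (G : {group gT}) (A B : gT) :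
  (alpha = 7 %[mod 9])%Z ->
  (beta = 7 %[mod 9])%Z ->
  logn 3 `|alpha - beta|%N = 2 ->
  is_Gab alpha beta G A B ->
  forall P : {group gT}, P \in ('Syl_3(G))%g ->
    [/\ #|P| = 3 ^ 8, nil_class P = 5,
        #[A.`_3]%g = 27, #[B.`_3]%g = 27 & #[([~ A, B]%g).`_3]%g = 9].
Proof.
move=> alpha7 beta7 ab2 Gab P sylP; have G_38 := is_Gab_card alpha7 beta7 Gab.
(* Every element has trivial [N]-th power, so [alpha] and [beta] can be replaced by their residues
   modulo [N]; the factor 27 preserves their classes modulo 9 and 27. *)
have [defG [rel _]] := Gab; pose N := 27 * #|[set: gT]|.
have N_gt0 : 0 < N by rewrite muln_gt0 cardG_gt0.
have N27 : 27 %| N by apply: dvdn_mulr.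
have N9 : 9 %| N by apply: dvdn_trans N27.
have expN (x : gT) : (x ^+ N = 1)%g.
  by rewrite /N mulnC expgM expg_cardG ?inE ?expg1n.
have alphaE := modz_abs alpha N_gt0; have betaE := modz_abs beta N_gt0.
have {}rel := (Nrel_Grel (expN A) (expN B) alphaE betaE).1 rel.
have {}defG : G = <<[set A; B]>>%G by apply: val_inj.
rewrite {}defG in G_38 sylP.
apply: Nrel_Sylow3 rel G_38 sylP; try exact: absz_mod7.
apply/eqP=> /eqP; rewrite -eqz_nat -!modz_nat.
rewrite -(eqz_mod_dvdn N27 alphaE) -(eqz_mod_dvdn N27 betaE) eqz_mod_dvd dvdzE /=.
(* As [logn 3 0] is 0 by convention, the valuation hypothesis excludes [alpha = beta]. *)
have [eq_ab | neq_ab] := eqVneq alpha beta; first by rewrite eq_ab GRing.subrr in ab2.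
by rewrite (@pfactor_dvdn 3 3) ?ab2 // lt0n absz_eq0 GRing.subr_eq0.
Qed.
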